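(* For every positive integer $n$ and any ordered $n$-tuple of integers $(k_1,\ldots,k_n)$ the set $\{\varepsilon_{k_1[1]},\ldots,\varepsilon_{k_n[n]},\varsigma_{1[1]},\ldots,\varsigma_{1[n]}\}$ generates the semigroup $\mathscr{IO}_{\infty}(\mathbb{Z}^n_{\mathrm{lex}})$ as an inverse semigroup, and hence $\mathscr{IO}_{\infty}(\mathbb{Z}^n_{\mathrm{lex}})$ is finitely generated.
   Context: $L_n=\{1,\ldots,n\}$ with its usual order; $L_n\times_{\mathrm{lex}}\mathbb{Z}$ is $L_n\times\mathbb{Z}$ with the lexicographic order: $(i,m)\leqslant(j,l)$ iff $i<j$, or $i=j$ and $m\le l$. $\mathscr{IO}_{\infty}(\mathbb{Z}^n_{\mathrm{lex}})$ is the inverse monoid of all injective partial maps $\alpha$ from $L_n\times\mathbb{Z}$ to itself that are monotone ($x\leqslant y$ in $\operatorname{dom}\alpha$ implies $(x)\alpha\leqslant(y)\alpha$) and such that both $\operatorname{dom}\alpha$ and $\operatorname{ran}\alpha$ have finite complement in $L_n\times\mathbb{Z}$; the operation is composition of partial maps written on the right, $(x)(\alpha\beta)=((x)\alpha)\beta$. For $k\in\mathbb{Z}$ and $j\in\{1,\ldots,n\}$, $\varepsilon_{k[j]}$ and $\varsigma_{k[j]}$ are the total maps $L_n\times\mathbb{Z}\to L_n\times\mathbb{Z}$ given by: $(m,i)\varepsilon_{k[j]}=(m,i+1)$ if $m=j$ and $i>k$, and $(m,i)\varepsilon_{k[j]}=(m,i)$ otherwise; $(m,i)\varsigma_{k[j]}=(m,i+k)$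 if $m=j$, and $(m,i)\varsigma_{k[j]}=(m,i)$ if $m\ne j$. A subset $A$ of an inverse semigroup $S$ generates $S$ as an inverse semigroup if the intersection of all inverse subsemigroups of $S$ containing $A$ equals $S$. *)

(* Defs.v *)
From HB Require Import structures.
From mathcomp Require Import all_boot all_order all_algebra.
From mathcomp Require Import boolp classical_sets functions cardinality.
From mathcomp Require Import zify.

Set Implicit Arguments.
Unset Strict Implicit.
Unset Printing Implicit Defensive.

Local Open Scope classical_set_scope.
Local Open Scope group_scope.

(** * Inverse semigroups and generation *)

Definition inverse_of (S : magmaType) (x y : S) : Prop :=
  x * y * x = x /\ y * x * y = y.

HB.mixin Record Semigroup_isInverse S of Semigroup S := {
  unique_inverse : forall x : S, exists! y : S, inverse_of x y
}.

#[short(type="inverseSemigroupType")]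
HB.structure Definition InverseSemigroup :=
  {S of Semigroup S & Semigroup_isInverse S}.

Definition subsemigroup (S : semigroupType) (T : set S) : Prop :=
  forall x y, T x -> T y -> T (x * y).

(* A subsemigroup that is itself an inverse semigroup. *)
Definition inverse_subsemigroup (S : inverseSemigroupType) (T : set S) : Prop :=
  subsemigroup T /\ forall x, T x -> exists! y, T y /\ inverse_of x y.

(* [smallest C A] is the intersection of all the sets satisfying [C] that
   contain [A]. *)
Definition generates (S : semigroupType) (A : set S) : Prop :=
  smallest (@subsemigroup S) A = [set: S].

Definition generates_as_inverse (S : inverseSemigroupType) (A : set S) : Prop :=
  smallest (@inverse_subsemigroup S) A = [set: S].

Definition finitely_generated (S : semigroupType) : Prop :=
  exists A : set S, finite_set A /\ generates A.

Definition finitely_generated_as_inverse (S : inverseSemigroupType) : Prop :=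
  exists A : set S, finite_set A /\ generates_as_inverse A.

(** * The monoid of cofinite monotone partial injections *)

(* ['I_n] is [{0, ..., n - 1}], so the chain [L_n = {1, ..., n}] is shifted
   by one; [*l] carries the lexicographic order. *)
Notation lexZ n := ('I_n *l int)%type.

(* [f x = None] means that [x] is outside the domain of [f]. *)
Definition pdom (X : Type) (f : X -> option X) : set X :=
  [set x | exists y, f x = Some y].
Definition pran (X : Type) (f : X -> option X) : set X :=
  [set y | exists x, f x = Some y].

Definition pinjective (X : Type) (f : X -> option X) : Prop :=
  forall x y z, f x = Some z -> f y = Some z -> x = y.

Definition pmonotone d (X : porderType d) (f : X -> option X) : Prop :=
  forall x y u v, f x = Some u -> f y = Some v -> (x <= y)%O -> (u <= v)%O.

Definition is_IO n (f : lexZ n -> option (lexZ n)) : Prop :=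
  [/\ pinjective f, pmonotone f,
      finite_set (~` pdom f) & finite_set (~` pran f)].

Record IO (n : nat) := MkIO {
  IO_fun :> lexZ n -> option (lexZ n);
  IO_prop : is_IO IO_fun
}.

HB.instance Definition _ n := gen_eqMixin (IO n).
HB.instance Definition _ n := gen_choiceMixin (IO n).

Lemma IO_ext n (a b : IO n) : a =1 b -> a = b.
Proof.
case: a b => [f fP] [g gP] /= /funext fg; subst g.
by congr MkIO; exact: Prop_irrelevance.
Qed.

Lemma is_IO_id n : is_IO (@Some (lexZ n)).
Proof.
split.
- by move=> x y z [->] [->].
- by move=> x y u v [->] [->].
- by rewrite (_ : ~` _ = set0) //; apply/seteqP; split=> x //=; case; exists x.
- by rewrite (_ : ~` _ = set0) //; apply/seteqP; split=> x //=; case; exists x.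
Qed.

Definition IO_one n : IO n := MkIO (@is_IO_id n).

Lemma pcompE (X : Type) (f g : X -> option X) x z :
  pcomp g f x = Some z <-> exists2 y, f x = Some y & g y = Some z.
Proof.
rewrite /pcomp; split; first by case: (f x) => //= y gy; exists y.
by case=> y -> /= ->.
Qed.

Lemma is_IO_comp n (a b : IO n) : is_IO (pcomp b a).
Proof.
case: a b => [f [fi fm fd fr]] [g [gi gm gd gr]] /=; split.
- move=> x y z /pcompE[u fu gu] /pcompE[v fv gv].
  by rewrite (gi _ _ _ gu gv) in fu; exact: fi fu fv.
- move=> x y u v /pcompE[x' fx gx] /pcompE[y' fy gy] xy.
  exact: gm gx gy (fm _ _ _ _ fx fy xy).
- pose h y := if pselect (exists x, f x = Some y) is left e
              then [set sval (cid e)] else set0.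
  have fin : finite_set (~` pdom f `|` \bigcup_(y in ~` pdom g) h y).
    rewrite finite_setU; split=> //; apply: bigcup_finite => // y _.
    by rewrite /h; case: pselect => // e; exact: finite_set1.
  apply: sub_finite_set fin => x xn.
  have [[y fx]|] := pselect (pdom f x); last by left.
  right; exists y; first by move=> [z gy]; apply: xn; exists z; apply/pcompE; exists y.
  rewrite /h; case: pselect => [e|[]]; last by exists x.
  by case: (cid e) => x' /= fx'; exact: fi fx fx'.
- pose h y := if g y is Some z then [set z] else set0.
  have fin : finite_set (~` pran g `|` \bigcup_(y in ~` pran f) h y).
    rewrite finite_setU; split=> //; apply: bigcup_finite => // y _.
    by rewrite /h; case: (g y) => // z; exact: finite_set1.
  apply: sub_finite_set fin => z zn.
  have [[y gy]|] := pselect (pran g z); last by left.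
  right; exists y; last by rewrite /h gy.
  by move=> [x fx]; apply: zn; exists x; apply/pcompE; exists y.
Qed.

(* Maps act on the right: [a * b] is [a] followed by [b]. *)
Definition IO_mul n (a b : IO n) : IO n := MkIO (is_IO_comp a b).

Lemma IO_mulA n : associative (@IO_mul n).
Proof. by move=> a b c; apply: IO_ext => x /=; rewrite /pcomp; case: (a x). Qed.

Lemma IO_mul1 n : left_id (@IO_one n) (@IO_mul n).
Proof. by move=> a; apply: IO_ext. Qed.

Lemma IO_mulr1 n : right_id (@IO_one n) (@IO_mul n).
Proof. by move=> a; apply: IO_ext => x /=; rewrite /pcomp; case: (a x). Qed.

HB.instance Definition _ n :=
  isMonoid.Build (IO n) (@IO_mulA n) (@IO_mul1 n) (@IO_mulr1 n).

Definition pinv (X : Type) (f : X -> option X) (y : X) : option X :=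
  if pselect (exists x, f x = Some y) is left e then Some (sval (cid e)) else None.

Lemma pinvE (X : Type) (f : X -> option X) : pinjective f ->
  forall x y, pinv f y = Some x <-> f x = Some y.
Proof.
move=> fi x y; rewrite /pinv; case: pselect => [e|n]; last first.
  by split=> // fx; case: n; exists x.
case: (cid e) => x' /= fx'; split=> [[<-] //|fx].
by congr Some; exact: fi fx' fx.
Qed.

Lemma is_IO_inv n (a : IO n) : is_IO (pinv a).
Proof.
case: a => f [fi fm fd fr] /=; have fE := pinvE fi; split.
- by move=> x y z /fE fz /fE; rewrite fz => -[].
- move=> x y u v /fE fu /fE fv xy; rewrite Order.TotalTheory.leNgt.
  apply/negP => vu; have := fm _ _ _ _ fv fu (Order.POrderTheory.ltW vu) => yx.
  have e : x = y by apply: Order.POrderTheory.le_anti; rewrite xy yx.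
  by move: vu; rewrite e in fu; rewrite (fi _ _ _ fu fv) Order.POrderTheory.ltxx.
- rewrite (_ : pdom _ = pran f) //.
  by apply/seteqP; split=> y [x /fE fx]; exists x.
- rewrite (_ : pran _ = pdom f) //.
  by apply/seteqP; split=> x [y /fE fx]; exists y.
Qed.

Definition IO_inv n (a : IO n) : IO n := MkIO (is_IO_inv a).

Lemma IO_invE n (a : IO n) x y : IO_inv a y = Some x <-> a x = Some y.
Proof. by apply: pinvE; case: (IO_prop a). Qed.

Lemma IO_mulE n (a b : IO n) x : (a * b) x = obind b (a x).
Proof. by []. Qed.

Lemma IO_inverse_ofP n (a b : IO n) :
  inverse_of a b <-> forall x y, a x = Some y <-> b y = Some x.
Proof.
have half (c d : IO n) : c * d * c = c ->
    forall x y, c x = Some y -> d y = Some x.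
  move=> cdc x y cx; have := congr1 (fun e : IO n => e x) cdc.
  rewrite !IO_mulE cx /=; case dy: (d y) => [z|] //= cz.
  by congr Some; case: (IO_prop c) => ci _ _ _; exact: ci cz cx.
split=> [[aba bab] x y|ab].
  by split; [exact: half aba _ _|exact: half bab _ _].
split; apply: IO_ext => x; rewrite !IO_mulE.
  by case ax: (a x) => [y|] //=; move/ab: (ax) => -> /=.
by case bx: (b x) => [y|] //=; move/ab: (bx) => -> /=.
Qed.

Lemma IO_unique_inverse n (a : IO n) : exists! b : IO n, inverse_of a b.
Proof.
exists (IO_inv a); split.
  by apply/IO_inverse_ofP => x y; split=> /IO_invE.
move=> b /IO_inverse_ofP ab; apply: IO_ext => y.
case e: (IO_inv a y) => [x|]; first by move/IO_invE/ab: e => ->.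
by case by_: (b y) => [x|] //; move/ab/IO_invE: by_; rewrite e.
Qed.

HB.instance Definition _ n :=
  Semigroup_isInverse.Build (IO n) (@IO_unique_inverse n).

(** * The maps [eps k j] and [sigma k j] *)

Definition eps_map n (k : int) (j : 'I_n) (x : lexZ n) : lexZ n :=
  if (x.1 == j) && (k < x.2)%R then (x.1, x.2 + 1)%R else x.

Definition sigma_map n (k : int) (j : 'I_n) (x : lexZ n) : lexZ n :=
  if x.1 == j then (x.1, x.2 + k)%R else x.

Lemma is_IO_total n (f : lexZ n -> lexZ n) :
  injective f -> {homo f : x y / (x <= y)%O} -> finite_set (~` range f) ->
  is_IO (Some \o f).
Proof.
move=> fi fm fr; split.
- by move=> x y z [<-] [/fi].
- by move=> x y u v [<-] [<-] /fm.
- by rewrite (_ : ~` _ = set0) //; apply/seteqP; split=> x //=; case; exists (f x).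
- rewrite (_ : pran _ = range f) //; apply/seteqP; split=> y.
    by move=> [x [<-]]; exists x.
  by move=> [x _ <-]; exists x.
Qed.

Lemma lexZ_leE n (x y : lexZ n) :
  (x <= y)%O = (x.1 < y.1)%N || (x.1 == y.1) && (x.2 <= y.2)%R.
Proof.
case: x y => [i m] [j l]; rewrite Order.ProdLexiOrder.leEprodlexi /=.
by rewrite !Order.OrdinalOrder.leEord -val_eqE /=; case: ltngtP.
Qed.

Lemma eps_is_IO n (k : int) (j : 'I_n) : is_IO (Some \o eps_map k j).
Proof.
apply: is_IO_total.
- move=> [m x] [m' y]; rewrite /eps_map /=.
  have [->|nm] := eqVneq m j; have [->|nm'] := eqVneq m' j => //=.
  + by case: ifP => hx; case: ifP => hy -[] e; congr pair; lia.
  + by case: ifP => _ [e]; rewrite e eqxx in nm'.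
  + by case: ifP => _ [e]; rewrite e eqxx in nm.
- move=> [m x] [m' y]; rewrite !lexZ_leE /eps_map /=.
  have [->|nm] := eqVneq m j; have [->|nm'] := eqVneq m' j => //=.
  + rewrite ltnn /= => xy.
    by case: ifP; case: ifP => /=; rewrite ltnn eqxx /=; lia.
  + by case: ifP => _ /=; rewrite eq_sym (negbTE nm').
  + by case: ifP => _ /=; rewrite (negbTE nm).
- apply: (@sub_finite_set _ _ [set (j, (k + 1)%R)]); last exact: finite_set1.
  move=> [m x] xn; apply: contrapT => /= ne; apply: xn.
  have [mj|mj] := eqVneq m j; last first.
    by exists (m, x); rewrite // /eps_map /= (negbTE mj).
  subst m; have ne' : x <> (k + 1)%R by move=> e; apply: ne; rewrite e.
  have [kx|xk] := boolP (k < x)%R.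
    exists (j, (x - 1)%R) => //; rewrite /eps_map /= eqxx /=.
    by case: ifP => ?; congr pair; lia.
  by exists (j, x) => //; rewrite /eps_map /= eqxx /= (negbTE xk).
Qed.

Lemma sigma_is_IO n (k : int) (j : 'I_n) : is_IO (Some \o sigma_map k j).
Proof.
apply: is_IO_total.
- move=> [m x] [m' y]; rewrite /sigma_map /=.
  have [->|nm] := eqVneq m j; have [->|nm'] := eqVneq m' j => //=.
  + by case=> e; congr pair; lia.
  + by case=> e; rewrite e eqxx in nm'.
  + by case=> e; rewrite e eqxx in nm.
- move=> [m x] [m' y]; rewrite !lexZ_leE /sigma_map /=.
  have [->|nm] := eqVneq m j; have [->|nm'] := eqVneq m' j => //=.
  + by rewrite ltnn eqxx /=; lia.
  + by rewrite eq_sym (negbTE nm').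
  + by rewrite (negbTE nm).
- rewrite (_ : ~` _ = set0) //; apply/seteqP; split=> // -[m x]; apply.
  have [->|nm] := eqVneq m j.
    by exists (j, (x - k)%R) => //; rewrite /sigma_map /= eqxx; congr pair; lia.
  by exists (m, x); rewrite // /sigma_map /= (negbTE nm).
Qed.

Definition eps n (k : int) (j : 'I_n) : IO n := MkIO (eps_is_IO k j).
Definition sigma n (k : int) (j : 'I_n) : IO n := MkIO (sigma_is_IO k j).

(* Main.v *)
(** If [a] is undefined at the unique point [p = (j, k + 1)] missed by
    [e = eps k j], then [a = e^-1 (e a)], and [e a] is undefined at one point
    fewer than [a]; symmetrically, a point missing from the range of [a] is
    removed by [a = (a e^-1) e].  This reduces everything to total surjective
    maps, which are the order automorphisms of [L_n x Z].  Such an automorphism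
    commutes with immediate successors, so it permutes the copies of [Z]
    monotonically, hence trivially, and is a product of shifts of the copies.
    Only products of the generators and of their inverses are used, so the
    generators together with their inverses generate as a semigroup. *)

Require Import Defs.
From mathcomp Require Import all_boot all_order all_algebra.
From mathcomp Require Import boolp classical_sets functions cardinality.
From mathcomp Require Import zify.

Local Open Scope classical_set_scope.

Set Implicit Arguments.
Unset Strict Implicit.
Unset Printing Implicit Defensive.

Import Order.TTheory GRing.Theory.

(** * Order automorphisms of the lexicographic product *)

Lemma lexZ_ltE n (x y : lexZ n) :
  (x < y)%O = (x.1 < y.1)%N || (x.1 == y.1) && (x.2 < y.2)%R.
Proof. by rewrite ltNge lexZ_leE -!val_eqE /=; lia. Qed.

(** The preimage of the immediate successor of [f (i, m)] lies strictly above [(i, m)], hence not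
    below [(i, m + 1)]; this squeezes [f (i, m + 1)] between [f (i, m)] and that successor. *)
Lemma lexZ_aut_succ n (f : lexZ n -> lexZ n) (i : 'I_n) (m : int) :
  {mono f : x y / (x <= y)%O} -> (forall y, exists x, f x = y) ->
  f (i, m + 1)%R = ((f (i, m)).1, (f (i, m)).2 + 1)%R.
Proof.
move=> fm fs; have fl := leW_mono fm.
have [[j l] fz] := fs ((f (i, m)).1, (f (i, m)).2 + 1)%R.
have mz : ((i, m) < (j, l) :> lexZ n)%O.
  by rewrite -fl fz lexZ_ltE /= eqxx /=; lia.
have zm : ((i, (m + 1)%R) <= (j, l) :> lexZ n)%O.
  by move: mz; rewrite lexZ_ltE lexZ_leE /= -!val_eqE /=; lia.
have mm : ((i, m) < (i, (m + 1)%R) :> lexZ n)%O.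
  by rewrite lexZ_ltE /= eqxx /=; lia.
move: zm mm; rewrite -fm -fl fz; case: (f (i, m)) => a b /=.
case: (f _) => c d; rewrite lexZ_leE lexZ_ltE /= -!val_eqE /= => h1 h2.
by congr pair; [apply: val_inj => /=|]; lia.
Qed.

(** Commuting with successors makes [f] a translation of copy [i] onto copy [g i]; [g] is strictly
    increasing and onto, hence the identity. *)
Lemma lexZ_aut_shift n (f : lexZ n -> lexZ n) :
  {mono f : x y / (x <= y)%O} -> (forall y, exists x, f x = y) ->
  exists c : 'I_n -> int, forall i m, f (i, m) = (i, m + c i)%R.
Proof.
move=> fm fs; pose g i := (f (i, 0%R)).1; pose c i := (f (i, 0%R)).2.
have fE i m : f (i, m) = (g i, m + c i)%R.
  elim/int_ind: m => [|m IH|m IH]; first by rewrite add0r /g /c; case: (f _).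
    have -> : (m.+1 : int) = (m%:Z + 1)%R by lia.
    by rewrite lexZ_aut_succ // IH /=; congr pair; lia.
  (* Going down, the successor law is applied at [- m.+1] and solved for the value there. *)
  have e : (- m%:Z)%R = (- (m.+1)%:Z + 1)%R by lia.
  move: IH; rewrite {1}e lexZ_aut_succ //; case: (f _) => a b /= [-> E].
  by congr pair; lia.
have g_mono (i j : 'I_n) : (i < j)%N -> (g i < g j)%N.
  (* The first point is sent to [(g i, c j + 1)], which would exceed [f (j, 0) = (g j, c j)] if
     [g i = g j]. *)
  move=> ij; have := fm (i, (c j - c i + 1)%R) (j, 0%R).
  by rewrite !fE !lexZ_leE /= ij -!val_eqE /=; lia.
exists c => i m; rewrite fE; congr pair; move: i {m}.
suff gk k (i : 'I_n) : (i < k)%N -> g i = i by move=> i; apply: (gk i.+1).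
elim: k i => // k IH i ik.
(* Here [g j = i]: [j < i] contradicts the induction hypothesis at [j], and [i < j] gives [g i < i],
   contradicting it at [g i]. *)
have [[j l]] := fs (i, 0%R); rewrite fE => -[gj _].
have [ji|ij|ij] := ltngtP j i; last by rewrite -{2}gj; congr g; apply: val_inj.
  by have e := IH j (leq_trans ji ik); rewrite -gj e ltnn in ji.
have gi : (g i < i)%N by rewrite -{2}gj g_mono.
by have := g_mono _ _ gi; rewrite (IH (g i)) ?ltnn // (leq_trans gi ik).
Qed.

Local Open Scope group_scope.

(** * Identities for shifts, the maps [eps k j] and their inverses *)

Section Identities.
Variable n : nat.
Implicit Types (a b : IO n) (j : 'I_n) (k l : int).

(** In a total order an injective monotone map is strictly monotone, hence reflects the order. *)
Lemma IO_total_mono a :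
  (forall x, a x != None) -> exists2 f : lexZ n -> lexZ n,
    a =1 Some \o f & {mono f : x y / (x <= y)%O}.
Proof.
move=> aT; exists (fun x => odflt x (a x)).
  by move=> x /=; case: (a x) (aT x).
have aE x : a x = Some (odflt x (a x)) by case: (a x) (aT x).
case: (IO_prop a) => ai am _ _; apply: le_mono => x y.
rewrite !lt_def => /andP[yx xy]; rewrite (am _ _ _ _ (aE x) (aE y) xy) andbT.
by apply: contraNneq yx => e; apply/eqP/(ai _ _ _ (aE y)); rewrite e -aE.
Qed.

Lemma sigmaE k j x : sigma k j x = Some (sigma_map k j x).
Proof. by []. Qed.

Lemma epsE k j x : eps k j x = Some (eps_map k j x).
Proof. by []. Qed.

Lemma IO_mul_Some a b x y : a x = Some y -> (a * b) x = b y.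
Proof. by rewrite IO_mulE => ->. Qed.

Lemma sigma_mulE a k j x : (sigma k j * a) x = a (sigma_map k j x).
Proof. by []. Qed.

Lemma eps_mulE a k j x : (eps k j * a) x = a (eps_map k j x).
Proof. by []. Qed.

Lemma sigmaD k l j : sigma (k + l)%R j = sigma k j * sigma l j.
Proof.
apply: IO_ext => -[i m]; rewrite sigma_mulE !sigmaE /sigma_map /=.
by case: (eqVneq i j) => [->|ij] /=; rewrite ?eqxx ?(negbTE ij) //= addrA.
Qed.

Lemma sigma0 j : sigma 0%R j = 1.
Proof.
apply: IO_ext => -[i m]; rewrite sigmaE /sigma_map /=.
by case: eqP => // _; rewrite addr0.
Qed.

Lemma sigmaVK k j : sigma (- k)%R j * sigma k j = 1.
Proof. by rewrite -sigmaD addNr sigma0. Qed.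

Lemma sigmaKV k j : sigma k j * sigma (- k)%R j = 1.
Proof. by rewrite -sigmaD addrN sigma0. Qed.

Lemma IO_inv_eq a b : inverse_of a b -> IO_inv a = b.
Proof.
move=> ab; have [c [_ cu]] := IO_unique_inverse a.
rewrite -(cu _ ab) (cu (IO_inv a)) //.
by apply/IO_inverse_ofP => x y; split=> /IO_invE.
Qed.

Lemma IO_inverse_of a : inverse_of a (IO_inv a).
Proof. by apply/IO_inverse_ofP => x y; split=> /IO_invE. Qed.

Lemma IO_inv_sigma k j : IO_inv (sigma k j) = sigma (- k)%R j.
Proof. by apply: IO_inv_eq; split; rewrite ?sigmaKV ?sigmaVK mul1g. Qed.

(** The shift by [k - l] carries the threshold [l] to [k]; so a single [eps k j] per copy, with [k]
    arbitrary, yields all the others. *)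
Lemma eps_conj k l j : eps l j = sigma (k - l)%R j * eps k j * sigma (l - k)%R j.
Proof.
apply: IO_ext => -[i m]; rewrite -mulgA sigma_mulE eps_mulE !sigmaE epsE.
rewrite /sigma_map /eps_map /=.
case: (eqVneq i j) => [->|ij] /=; last by rewrite (negbTE ij) /= (negbTE ij).
have -> : (k < m + (k - l))%R = (l < m)%R by lia.
by case: ifP => _ /=; rewrite !eqxx /=; congr (Some (j, _)); lia.
Qed.

Lemma IO_inv_conj a b c : b * c = 1 -> c * b = 1 ->
  IO_inv (b * a * c) = b * IO_inv a * c.
Proof.
move=> bc cb; have [h1 h2] := IO_inverse_of a.
have cK x : x * c * b = x by rewrite -mulgA cb mulg1.
by apply: IO_inv_eq; split; rewrite !mulgA !cK -2!(mulgA b) (h1, h2).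
Qed.

Lemma IO_inv_eps_conj k l j :
  IO_inv (eps l j) = sigma (k - l)%R j * IO_inv (eps k j) * sigma (l - k)%R j.
Proof.
have e : (l - k = - (k - l))%R by rewrite opprB.
by rewrite {1}(eps_conj k l j) IO_inv_conj // e ?sigmaKV ?sigmaVK.
Qed.

Lemma eps_map_neq k j x : eps_map k j x <> (j, k + 1)%R.
Proof.
case: x => i m; rewrite /eps_map /=; case: ifP => [/andP[_ km] [_]|nkm [ij mk]].
  by lia.
by rewrite ij eqxx mk /= in nkm; lia.
Qed.

Lemma eps_map_surj k j y : y <> (j, k + 1)%R -> exists x, eps_map k j x = y.
Proof.
case: y => i m ne; have [ij|ij] := eqVneq i j; last first.
  by exists (i, m); rewrite /eps_map /= (negbTE ij).
subst i; have mk : m <> (k + 1)%R by move=> e; apply: ne; rewrite e.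
have [km|km] := boolP (k < m)%R.
  exists (j, m - 1)%R; rewrite /eps_map /= eqxx /=.
  by case: ifP => ?; congr pair; lia.
by exists (j, m); rewrite /eps_map /= (negbTE km) andbF.
Qed.

Lemma IO_inv_eps k j x : IO_inv (eps k j) (eps_map k j x) = Some x.
Proof. by apply/IO_invE. Qed.

Lemma IO_inv_eps_hole k j : IO_inv (eps k j) (j, k + 1)%R = None.
Proof.
case e: (IO_inv _ _) => [x|] //; move/IO_invE: e.
by rewrite epsE => -[/eps_map_neq].
Qed.

Lemma IO_mul_epsVl a k j : a (j, k + 1)%R = None ->
  a = IO_inv (eps k j) * (eps k j * a).
Proof.
move=> aN; apply: IO_ext => y; rewrite IO_mulE.
have [->|/eps_map_surj[x <-]] := pselect (y = (j, k + 1)%R).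
  by rewrite IO_inv_eps_hole.
by rewrite IO_inv_eps.
Qed.

Lemma IO_mul_epsVr a k j : (forall x, a x <> Some (j, k + 1)%R) ->
  a = a * IO_inv (eps k j) * eps k j.
Proof.
move=> aN; apply: IO_ext => x; case ax: (a x) => [y|]; last by rewrite !IO_mulE ax.
have [|z ez] := @eps_map_surj k j y; last first.
  by rewrite -mulgA (IO_mul_Some _ ax) -ez (IO_mul_Some _ (IO_inv_eps _ _ _)) epsE.
by move=> yE; apply: (aN x); rewrite ax yE.
Qed.

End Identities.

(* [p = (j, k + 1)] has no preimage under [eps_map k j], so it is dropped from
   the cover [s]. *)
Lemma cover_eps_preimage n (k : int) (j : 'I_n) (P : set (lexZ n)) s :
  P (j, k + 1)%R -> (forall x, P x -> x \in s) ->
  exists2 s' : seq (lexZ n), (size s' < size s)%N &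
    forall x, P (eps_map k j x) -> x \in s'.
Proof.
move=> Pp Ps; pose p : lexZ n := (j, k + 1)%R.
exists (pmap (IO_inv (eps k j)) (rem p s)).
  rewrite size_pmap (leq_ltn_trans (count_size _ _)) // size_rem; last exact: Ps.
  by rewrite prednK // -has_predT; apply/hasP; exists p => //; apply: Ps.
move=> x Px; rewrite mem_pmap; apply/mapP.
exists (eps_map k j x); last by rewrite IO_inv_eps.
have ne : eps_map k j x != p by apply/eqP/eps_map_neq.
have := Ps _ Px; rewrite (perm_mem (perm_to_rem (Ps _ Pp))) inE.
by rewrite (negbTE ne).
Qed.

(** * Subsemigroups containing the generators and their inverses *)

Section Generation.
Variables (n : nat) (k : 'I_n -> int) (T : set (IO n)).
Hypotheses (n_gt0 : (0 < n)%N) (TM : subsemigroup T).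
Hypotheses (Teps : forall j, T (eps (k j) j))
           (TepsV : forall j, T (IO_inv (eps (k j) j)))
           (Tsigma : forall j, T (sigma 1%R j))
           (TsigmaV : forall j, T (IO_inv (sigma 1%R j))).

Lemma mem_one : T 1.
Proof.
(* Positivity of [n] provides a copy to shift forth and back. *)
rewrite -(sigmaKV 1%R (Ordinal n_gt0)) -IO_inv_sigma.
by apply: TM.
Qed.

Lemma mem_sigma (l : int) j : T (sigma l j).
Proof.
elim/int_ind: l => [|m IH|m IH]; first by rewrite sigma0; exact: mem_one.
  by rewrite -addn1 PoszD sigmaD; apply: TM.
rewrite -addn1 PoszD opprD sigmaD -(IO_inv_sigma 1%R); exact: TM.
Qed.

Lemma mem_eps (l : int) j : T (eps l j).
Proof.
by rewrite (eps_conj (k j)); do 2?[apply: (TM)]; rewrite //; exact: mem_sigma.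
Qed.

Lemma mem_inv_eps (l : int) j : T (IO_inv (eps l j)).
Proof.
by rewrite (IO_inv_eps_conj (k j)); do 2?[apply: (TM)]; rewrite //; exact: mem_sigma.
Qed.

Lemma mem_shift (a : IO n) (c : 'I_n -> int) :
  (forall i m, a (i, m) = Some (i, m + c i)%R) -> T a.
Proof.
move=> aE; pose b s := \prod_(j <- s) sigma (c j) j.
have Tb s : T (b s).
  by apply: big_ind => [|x y Tx Ty|j _]; [exact: mem_one|exact: TM|exact: mem_sigma].
(* Without repetitions in [s], each copy is shifted at most once. *)
have bE s i m : uniq s ->
    b s (i, m) = Some (i, m + (if i \in s then c i else 0))%R.
  elim: s m => [|j s IH] m /=; first by rewrite /b big_nil addr0.
  case/andP=> js us; rewrite /b big_cons sigma_mulE inE /sigma_map -/(b s).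
  rewrite [(i, m).1]/= [(i, m).2]/=; have [ij|ij] := eqVneq i j; last exact: IH.
  by rewrite IH // ij (negbTE js) addr0.
rewrite (_ : a = b (index_enum 'I_n)) //; apply: IO_ext => -[i m].
by rewrite aE bE ?index_enum_uniq // mem_index_enum.
Qed.

Lemma mem_bijective (a : IO n) :
  (forall x, a x != None) -> (forall y, exists x, a x = Some y) -> T a.
Proof.
move=> /IO_total_mono[f af fm] aS.
have [|c fc] := lexZ_aut_shift fm.
  by move=> y; have [x] := aS y; rewrite af => -[<-]; exists x.
by apply: (mem_shift (c := c)) => i m; rewrite af /= fc.
Qed.

Lemma mem_total (a : IO n) : (forall x, a x != None) -> T a.
Proof.
move=> aT; case: (IO_prop a) => _ _ _ /finite_seqP[s sE].
have {sE} : forall y, (forall x, a x <> Some y) -> y \in s.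
  move=> y ay; suff : [set` s] y by [].
  by rewrite -sE => -[x]; exact: ay.
(* The induction is on the length of any list covering the points missed by [a]; the list need not
   be exact. *)
elim/ltn_ind: {s}(size s) {-2}s (erefl (size s)) a aT => N IH s sN a aT sP.
have [aS|] := pselect (forall y, exists x, a x = Some y).
  exact: mem_bijective.
move=> /existsNP[[j m] /forallNP am].
pose l := (m - 1)%R; have ml : m = (l + 1)%R by rewrite /l; lia.
rewrite ml in am; rewrite (IO_mul_epsVr am); apply: TM; last exact: mem_eps.
have [s' ss' sP'] := cover_eps_preimage am sP.
apply: (IH (size s') _ s') => // [|x|x xN]; first by rewrite -sN.
  (* The product stays total: the values of [a] avoid [(j, l + 1)], the only point where
     [IO_inv (eps l j)] is undefined. *)
  case ax: (a x) (aT x) => [y|] // _; rewrite (IO_mul_Some _ ax).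
  have [|z <-] := @eps_map_surj n l j y; last by rewrite IO_inv_eps.
  by move=> yE; apply: (am x); rewrite ax yE.
apply: sP' => y ay; apply: (xN y).
by rewrite (IO_mul_Some _ ay) IO_inv_eps.
Qed.

(** Induction on a list covering the points outside the domain, with total maps as base. As [T] is
    only a subsemigroup, this serves both notions of generation. *)
Lemma mem_generated (a : IO n) : T a.
Proof.
case: (IO_prop a) => _ _ /finite_seqP[s sE] _.
have {sE} : forall x, a x = None -> x \in s.
  move=> x ax; suff : [set` s] x by [].
  by rewrite -sE => -[y]; rewrite ax.
elim/ltn_ind: {s}(size s) {-2}s (erefl (size s)) a => N IH s sN a sP.
have [aT|] := pselect (forall x, a x != None); first exact: mem_total.
move=> /existsNP[[j m] /negP]; rewrite negbK => /eqP am.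
pose l := (m - 1)%R; have ml : m = (l + 1)%R by rewrite /l; lia.
rewrite ml in am; rewrite (IO_mul_epsVl am).
apply: TM; first exact: mem_inv_eps.
have [s' ss' sP'] := cover_eps_preimage (P := [set x | a x = None]) am sP.
by apply: (IH (size s') _ s') => //; rewrite -sN.
Qed.

End Generation.

(** * Generation as an inverse semigroup and as a semigroup *)

Lemma inverse_subsemigroupV n (T : set (IO n)) (a : IO n) :
  inverse_subsemigroup T -> T a -> T (IO_inv a).
Proof. by move=> [_ Tinv] /Tinv[b [[Tb /IO_inv_eq ->] _]]. Qed.

Theorem theorem3p9 :
  forall n : nat, (0 < n)%N ->
    (forall k : n.-tuple int,
       generates_as_inverse
         (range (fun j : 'I_n => eps (tnth k j) j)
            `|` range (fun j : 'I_n => sigma 1%R j)))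
    /\ finitely_generated_as_inverse (IO n)
    /\ finitely_generated (IO n).
Proof.
move=> n n_gt0.
pose A (k : n.-tuple int) := range (fun j : 'I_n => eps (tnth k j) j)
  `|` range (fun j : 'I_n => sigma 1%R j).
have finA k : finite_set (A k).
  by rewrite finite_setU; split; apply: finite_image; exact: finite_finset.
have genA k : generates_as_inverse (A k).
  rewrite /generates_as_inverse -subTset => a _ T [Tinv AT].
  have Ae j : T (eps (tnth k j) j) by apply: AT; left; exists j.
  have As j : T (sigma 1%R j) by apply: AT; right; exists j.
  case: (Tinv) => TM _; apply: (mem_generated n_gt0 TM) => // j.
    exact: inverse_subsemigroupV.
  exact: inverse_subsemigroupV.
pose k0 : n.-tuple int := nseq_tuple n 0%R.
split=> //; split; first by exists (A k0).
(* A plain subsemigroup need not be closed under inverses, so those of the generators are adjoined;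
   the set stays finite. *)
exists (A k0 `|` (@IO_inv n) @` A k0); split.
  by rewrite finite_setU; split=> //; exact: finite_image.
rewrite /generates -subTset => a _ T [TM AT].
have Ae j : A k0 (eps (tnth k0 j) j) by left; exists j.
have As j : A k0 (sigma 1%R j) by right; exists j.
apply: (mem_generated n_gt0 TM (k := tnth k0)) => j; apply: AT.
- by left.
- by right; exists (eps (tnth k0 j) j).
- by left.
- by right; exists (sigma 1%R j).
Qed.
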